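(* Let $(H,\circ)$ be a hypersemigroup. Then $H$ is right quasi-regular if and only if, for every fuzzy subset $f$ of $H$, we have $f\preceq f\circ 1\circ f\circ 1$.
   Context: Let $\mathcal{P}^*(H)$ denote the set of nonempty subsets of $H$. A hypergroupoid is a nonempty set $H$ with a hyperoperation $\circ: H\times H\to \mathcal{P}^*(H)$, $(a,b)\mapsto a\circ b$; it induces an operation $*$ on $\mathcal{P}^*(H)$ by $A*B=\bigcup_{(a,b)\in A\times B}(a\circ b)$. A hypersemigroup is a hypergroupoid $H$ such that $(x\circ y)*\{z\}=\{x\}*(y\circ z)$ for all $x,y,z\in H$. A hypersemigroup $H$ is called right quasi-regular if for every $a\in H$ there exist $x,y\in H$ such that $a\in (a\circ x)*(a\circ y)$. A fuzzy subset of $H$ is a mapping $f:H\to[0,1]$ into the real closed unit interval. For $a\in H$ put $A_a=\{(y,z)\in H\times H\mid a\in y\circ z\}$. For fuzzy subsets $f,g$ of $H$, the fuzzy subset $f\circ g$ of $H$ is defined by $(f\circ g)(a)=\sup_{(y,z)\in A_a}\min\{f(y),g(z)\}$ if $A_a\neq\emptyset$, and $(f\circ g)(a)=0$ if $A_a=\emptyset$. (The same symbol $\circ$ is used for the hyperoperation on $H$ and the product of fuzzy subsets.) When $H$ is a hypersemigroup this product of fuzzy subsets is associative, so iterated products are written without parentheses. The order on fuzzy subsets is $f\preceq g$ if and only if $f(x)\le g(x)$ for every $x\in H$. The symbol $1$ denotes the fuzzy subset of $H$ with $1(x)=1$ for every $x\in H$. *)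

(* Defs.v *)
From mathcomp Require Import all_boot all_order all_algebra.
From mathcomp Require Import boolp classical_sets reals interval_inference.

Set Implicit Arguments.
Unset Strict Implicit.
Unset Printing Implicit Defensive.

Import Order.TTheory GRing.Theory Num.Theory.

Local Open Scope classical_set_scope.
Local Open Scope ring_scope.

Record hypergroupoid := Hypergroupoid {
  hcarrier :> Type;
  hcarrier_inhabited : inhabited hcarrier;
  hop : hcarrier -> hcarrier -> set hcarrier;
  hop_nonempty : forall a b, hop a b !=set0
}.

(* Defined on all subsets; it preserves nonemptiness, so it restricts to an
   operation on the nonempty ones. *)
Definition hmul (H : hypergroupoid) (A B : set H) : set H :=
  \bigcup_(p in A `*` B) hop p.1 p.2.

Definition hypersemigroup (H : hypergroupoid) : Prop :=
  forall x y z : H, hmul (hop x y) [set z] = hmul [set x] (hop y z).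

Definition right_quasi_regular (H : hypergroupoid) : Prop :=
  forall a : H, exists x y : H, hmul (hop a x) (hop a y) a.

Definition fuzzy (R : realType) (H : hypergroupoid) : Type := H -> {i01 R}.

Definition factorizations (H : hypergroupoid) (a : H) : set (H * H) :=
  [set p | hop p.1 p.2 a].

Definition fuzzy_mul_val (R : realType) (H : hypergroupoid)
    (f g : fuzzy R H) (a : H) : R :=
  if factorizations a == set0 then 0
  else sup [set Num.min (f p.1)%:num (g p.2)%:num | p in factorizations a].

Lemma fuzzy_mul_val_ge0 (R : realType) (H : hypergroupoid)
    (f g : fuzzy R H) (a : H) : 0 <= fuzzy_mul_val f g a.
Proof.
rewrite /fuzzy_mul_val; case: eqVneq => [//|/set0P [p Ap]].
apply: (@le_trans _ _ (Num.min (f p.1)%:num (g p.2)%:num)).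
  by rewrite le_min !ge0.
apply: ub_le_sup; last by exists p.
by exists 1 => _ [q _ <-]; rewrite ge_min; apply/orP; left; exact: le1.
Qed.

Lemma fuzzy_mul_val_le1 (R : realType) (H : hypergroupoid)
    (f g : fuzzy R H) (a : H) : fuzzy_mul_val f g a <= 1.
Proof.
rewrite /fuzzy_mul_val; case: eqVneq => [_|/set0P [p Ap]]; first exact: ler01.
apply: ge_sup; first by eexists; exists p.
by move=> _ [q _ <-]; rewrite ge_min; apply/orP; left; exact: le1.
Qed.

Definition fuzzy_mul (R : realType) (H : hypergroupoid)
    (f g : fuzzy R H) : fuzzy R H :=
  fun a => Itv01 (fuzzy_mul_val_ge0 f g a) (fuzzy_mul_val_le1 f g a).

Definition fuzzy_one (R : realType) (H : hypergroupoid) : fuzzy R H :=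
  fun=> 1%:i01.
Arguments fuzzy_one : clear implicits.

Definition fuzzy_le (R : realType) (H : hypergroupoid) (f g : fuzzy R H) : Prop :=
  forall x : H, (f x)%:num <= (g x)%:num.

(* Main.v *)
Require Import Defs.
From mathcomp Require Import all_boot all_order all_algebra.
From mathcomp Require Import boolp classical_sets reals interval_inference.

Set Implicit Arguments.
Unset Strict Implicit.
Unset Printing Implicit Defensive.

Import Order.TTheory GRing.Theory Num.Theory.

Local Open Scope classical_set_scope.
Local Open Scope ring_scope.

(** Unfolding the suprema, [f o 1 o f o 1] is bounded below at [a] by
    [min (f b) (f c)] whenever [a] lies in [b o x o c o y], and conversely a
    positive value at [a] is witnessed by such a factorization with [f b] and
    [f c] positive ([fuzzy_mul_ge], [fuzzy_mul_gt]).  Right quasi-regularity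
    provides a factorization with [b = c = a], up to the rebracketing
    [(a o x) * (a o y) = ((a o x) * a) * y] of [hop_assoc], which gives the
    inequality.  For the converse, take for [f] the characteristic function of
    [a]: its value at [a] is 1, so the product is positive there, and positivity
    of [f b] and [f c] forces [b = c = a]. *)

(** Associativity, read on elements: it trades the middle element [v] of a
    factorization of [a] through [b o y] for one through [u o b]. *)
Lemma hop_assoc (H : hypergroupoid) (hH : hypersemigroup H) (u b y a : H) :
  (exists2 v, hop b y v & hop u v a) <-> (exists2 w, hop u b w & hop w y a).
Proof.
have E : hmul (hop u b) [set y] a = hmul [set u] (hop b y) a by rewrite hH.
split=> [[v bv uv]|[w uw wy]].
- have : hmul [set u] (hop b y) a by exists (u, v).
  by rewrite -E => -[[w _] [/= uw ->] wy]; exists w.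
- have : hmul (hop u b) [set y] a by exists (w, y).
  by rewrite E => -[[_ v] [/= -> bv] uv]; exists v.
Qed.

Section FuzzyProduct.
Variables (R : realType) (H : hypergroupoid).
Implicit Types (f g : fuzzy R H) (a y z : H) (c : R).

Lemma fuzzy_mul_ge f g c a y z : hop y z a ->
  c <= (f y)%:num -> c <= (g z)%:num -> c <= (fuzzy_mul f g a)%:num.
Proof.
move=> ayz cf cg /=; rewrite /fuzzy_mul_val.
have Ayz : factorizations a (y, z) by [].
case: eqVneq => [A0|_]; first by rewrite A0 in Ayz.
apply: (@le_trans _ _ (Num.min (f y)%:num (g z)%:num)).
  by rewrite le_min cf cg.
apply: ub_le_sup; last by exists (y, z).
by exists 1 => _ [q _ <-]; rewrite ge_min; apply/orP; left; exact: le1.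
Qed.

(** Although the supremum need not be attained, every value strictly below it
    is exceeded by some factorization; [0 <= c] excludes the case where [a] has
    no factorization at all. *)
Lemma fuzzy_mul_gt f g c a : 0 <= c -> c < (fuzzy_mul f g a)%:num ->
  exists y z, [/\ hop y z a, c < (f y)%:num & c < (g z)%:num].
Proof.
move=> c0 /=; rewrite /fuzzy_mul_val.
case: eqVneq => [_ /(le_lt_trans c0)|/set0P [p Ap]]; first by rewrite ltxx.
move=> /sup_gt[]; first by eexists; exists p.
by move=> _ [[y z] Ayz <-]; rewrite lt_min => /andP[cf cg]; exists y, z.
Qed.

Definition fuzzy_char a : fuzzy R H :=
  fun x => if `[< x = a >] then 1%:i01 else 0%:i01.

Lemma fuzzy_char_id a : (fuzzy_char a a)%:num = 1.
Proof. by rewrite /fuzzy_char; case: asboolP. Qed.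

Lemma fuzzy_char_gt0 a x : 0 < (fuzzy_char a x)%:num -> x = a.
Proof. by rewrite /fuzzy_char; case: asboolP => //= _; rewrite ltxx. Qed.

End FuzzyProduct.

Theorem theorem11 (R : realType) (H : hypergroupoid) (hH : hypersemigroup H) :
  right_quasi_regular H <->
  forall f : fuzzy R H,
    fuzzy_le f
      (fuzzy_mul (fuzzy_mul (fuzzy_mul f (fuzzy_one R H)) f) (fuzzy_one R H)).
Proof.
split=> [rqr f a|le_prod a].
- have [x [y [[u v] [/= axu ayv] uva]]] := rqr a.
  have /(hop_assoc hH)[w uaw wya] : exists2 v, hop a y v & hop u v a by exists v.
  have le1f : (f a)%:num <= (fuzzy_one R H a)%:num by exact: le1.
  apply: (fuzzy_mul_ge wya) => //.
  apply: (fuzzy_mul_ge uaw) => //.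
  exact: (fuzzy_mul_ge axu).
- have := le_prod (fuzzy_char R a) a; rewrite fuzzy_char_id.
  move=> /(lt_le_trans ltr01)/(fuzzy_mul_gt (lexx 0))[w [y [wya + _]]].
  move=> /(fuzzy_mul_gt (lexx 0))[u [c [ucw + /fuzzy_char_gt0 ca]]].
  move=> /(fuzzy_mul_gt (lexx 0))[b [x [bxu /fuzzy_char_gt0 ba _]]].
  subst b c.
  have /(hop_assoc hH)[v ayv uva] : exists2 w, hop u a w & hop w y a by exists w.
  by exists x, y, (u, v).
Qed.
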